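(* Let $(E,[\cdot,\cdot]_E,\rho,\omega)$ be a symplectic Lie algebroid over a manifold $M$. Define a multiplication $\star:\Gamma(E)\times\Gamma(E)\to\Gamma(E)$ by $$\omega(e_1\star e_2,e_3)=\rho(e_1)\omega(e_2,e_3)+\tfrac12\rho(e_3)\omega(e_1,e_2)-\omega(e_2,[e_1,e_3]_E),\qquad \forall e_1,e_2,e_3\in\Gamma(E).$$ Then $(E,\star,\rho,(\cdot,\cdot)_-=\omega)$ is a pre-symplectic algebroid, and it satisfies $$[e_1,e_2]_E=e_1\star e_2-e_2\star e_1,\qquad\forall e_1,e_2\in\Gamma(E).$$
   Context: All vector bundles are real, of finite rank, over a fixed smooth manifold $M$; bundle maps cover the identity of $M$. A Lie algebroid $(E,[\cdot,\cdot]_E,\rho)$ is a vector bundle $E\to M$ with a Lie algebra structure $[\cdot,\cdot]_E$ on $\Gamma(E)$ and a bundle map $\rho:E\to TM$ (the anchor) such that $[e_1,fe_2]_E=f[e_1,e_2]_E+\rho(e_1)(f)e_2$ for $e_1,e_2\in\Gamma(E)$, $f\in C^\infty(M)$. A symplectic Lie algebroid $(E,[\cdot,\cdot]_E,\rho,\omega)$ is a Lie algebroid together with a nondegenerate $\omega\in\Gamma(\wedge^2E^* )$ that is closed, i.e. for all $x,y,z\in\Gamma(E)$ $$\rho(x)\omega(y,z)-\rho(y)\omega(x,z)+\rho(z)\omega(x,y)-\omega([x,y]_E,z)+\omega([x,z]_E,y)-\omega([y,z]_E,x)=0.$$ A pre-symplectic algebroid $(E,\star,\rho,(\cdot,\cdot)_-)$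 is a vector bundle $E\to M$ equipped with a nondegenerate skew-symmetric ($C^\infty(M)$-)bilinear form $(\cdot,\cdot)_-$, an ($\mathbb R$-bilinear) multiplication $\star:\Gamma(E)\times\Gamma(E)\to\Gamma(E)$ and a bundle map $\rho:E\to TM$ such that, with the commutator bracket $[e_1,e_2]_\star=e_1\star e_2-e_2\star e_1$, for all $e_1,e_2,e_3\in\Gamma(E)$: (i) $(e_1,e_2,e_3)-(e_2,e_1,e_3)=\frac16 D\,T(e_1,e_2,e_3)$; (ii) $\rho(e_1)(e_2,e_3)_-=(e_1\star e_2-\frac12D(e_1,e_2)_-,\,e_3)_-+(e_2,[e_1,e_3]_\star)_-$. Here $(e_1,e_2,e_3)=e_1\star(e_2\star e_3)-(e_1\star e_2)\star e_3$; $T(e_1,e_2,e_3)=(e_1\star e_2,e_3)_-+(e_1,e_2\star e_3)_--(e_2\star e_1,e_3)_--(e_2,e_1\star e_3)_-\in C^\infty(M)$; and $D:C^\infty(M)\to\Gamma(E)$ is defined by $(Df,e)_-=\rho(e)(f)$. *)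

(* Defs.v *)
From HB Require Import structures.
From mathcomp Require Import all_boot all_order all_algebra.
From mathcomp Require Import all_classical all_reals topology normedtype landau derive.
Import Order.TTheory GRing.Theory Num.Theory.
Import numFieldNormedType.Exports.

Set Implicit Arguments.
Unset Strict Implicit.
Unset Printing Implicit Defensive.

Local Open Scope classical_set_scope.
Local Open Scope ring_scope.

Section SmoothCalculus.
Context {R : realType}.

(* f is k times Frechet differentiable at every point of U (meant for open U):
   differentiability for k = 1, then recursively of all directional
   derivatives *)
Fixpoint ndifferentiable_on (V W : normedModType R) (k : nat) (U : set V)
    (f : V -> W) : Prop :=
  if k is k'.+1 then
    (forall x, U x -> differentiable f x) /\
    (forall v, ndifferentiable_on k' U ('D_v f))
  else True.

Definition smooth_on (V W : normedModType R) (U : set V) (f : V -> W) :=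
  forall k, ndifferentiable_on k U f.

Lemma near_eq_differentiable (V W : normedModType R) (f g : V -> W) (x : V) :
  (\near x, f x = g x) -> differentiable f x -> differentiable g x.
Proof.
move=> fg /diff_locallyP[cdf fE].
have fgx : f x = g x by exact: nbhs_singleton fg.
have gE : g \o shift x = cst (g x) + 'd f x +o_ 0 id.
  apply/eqaddoP => e e0; move/eqaddoP: fE => /(_ e e0) fE.
  have fg0 : \forall y \near (0 : V), f (y + x) = g (y + x).
    move: fg; rewrite (near_shift 0 x); apply: filterS => y /=.
    by rewrite subr0.
  near=> y.
  have : f (y + x) = g (y + x) by near: y.
  have : `|(f \o shift x - (cst (f x) + 'd f x)) y| <= e * `|y| by near: y.
  by rewrite !fctE /= -fgx => H <-.
by apply/diff_locallyP; rewrite (diff_unique cdf gE).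
Unshelve. all: by end_near. Qed.

Section Closure.
Context {V W : normedModType R}.
Variable U : set V.
Hypothesis oU : open U.

Lemma open_near (P : V -> Prop) x : (forall y, U y -> P y) -> U x ->
  \forall y \near x, P y.
Proof. by move=> UP Ux; have := open_nbhs_nbhs (conj oU Ux); apply: filterS. Qed.

Lemma ndiff_eq k (f g : V -> W) : (forall x, U x -> f x = g x) ->
  ndifferentiable_on k U f -> ndifferentiable_on k U g.
Proof.
elim: k f g => [//|k IH] f g fg /= [df Df]; split=> [x Ux|v].
  by apply: near_eq_differentiable (df x Ux); exact: open_near.
apply: IH (Df v) => x Ux; apply: near_eq_derive; exact: open_near.
Qed.

Lemma ndiffS k (f : V -> W) :
  ndifferentiable_on k.+1 U f -> ndifferentiable_on k U f.
Proof.
elim: k f => [//|k IH] f [df Df]; split=> // v; exact: IH (Df v).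
Qed.

Lemma ndiff_cst k (c : W) : ndifferentiable_on k U (cst c : V -> W).
Proof.
elim: k c => [//|k IH] c; split=> [x _|v]; first exact: differentiable_cst.
rewrite (_ : 'D_v _ = cst 0) ?IH//; apply/funext => x.
by rewrite derive_cst.
Qed.

Lemma ndiffD k (f g : V -> W) : ndifferentiable_on k U f ->
  ndifferentiable_on k U g -> ndifferentiable_on k U (f \+ g).
Proof.
elim: k f g => [//|k IH] f g [df Df] [dg Dg]; split=> [x Ux|v].
  by apply: differentiableD; auto.
apply: (@ndiff_eq k ('D_v f \+ 'D_v g)); last by apply: IH; [exact: Df|exact: Dg].
by move=> x Ux; rewrite deriveD//; apply: diff_derivable; auto.
Qed.

Lemma ndiff_sum k n (f : 'I_n -> V -> W) :
  (forall i, ndifferentiable_on k U (f i)) ->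
  ndifferentiable_on k U (fun x => \sum_(i < n) f i x).
Proof.
elim: n f => [|n IH] f kf.
  rewrite (_ : (fun _ => _) = cst 0); first exact: ndiff_cst.
  by apply/funext => x; rewrite big_ord0.
rewrite (_ : (fun _ => _) = (fun x => \sum_(i < n) f (widen_ord (leqnSn n) i) x)
   \+ f ord_max); last by apply/funext => x; rewrite big_ord_recr.
by apply: ndiffD => //; exact: IH.
Qed.

End Closure.

Section Scalar.
Context {V : normedModType R}.
Variable U : set V.
Hypothesis oU : open U.

Lemma ndiffM k (f g : V -> R) : ndifferentiable_on k U f ->
  ndifferentiable_on k U g -> ndifferentiable_on k U (f \* g).
Proof.
elim: k f g => [//|k IH] f g kf kg.
have [[df Df] [dg Dg]] := (kf, kg); split=> [x Ux|v].
  by apply: differentiableM; auto.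
apply: (@ndiff_eq _ _ _ oU k ((f \* 'D_v g) \+ (g \* 'D_v f))).
  move=> x Ux; have := @deriveM R V f g x v; rewrite /GRing.scale /= => ->//.
  - exact/diff_derivable/df.
  - exact/diff_derivable/dg.
apply: (ndiffD oU); apply: IH; [exact: ndiffS|exact: Dg|exact: ndiffS|exact: Df].
Qed.

Lemma differentiable_mxP m n (F : V -> 'M[R]_(m, n)) x :
  differentiable F x <-> forall i j, differentiable (fun y => F y i j) x.
Proof.
split=> [dF i j|dF].
  apply: (@differentiable_comp _ _ _ _ F (fun N : 'M[R]_(m, n) => N i j)) => //.
  exact: differentiable_coord.
rewrite (_ : F = \sum_(i < m) \sum_(j < n) (fun y => F y i j *: delta_mx i j)).
  apply: differentiable_sum => i; apply: differentiable_sum => j.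
  exact: differentiableZl.
apply/funext => y; rewrite fct_sumE [LHS]matrix_sum_delta.
by apply: eq_bigr => i _; rewrite fct_sumE.
Qed.

Lemma ndiff_mxP k m n (F : V -> 'M[R]_(m, n)) :
  ndifferentiable_on k U F <->
  forall i j, ndifferentiable_on k U (fun y => F y i j).
Proof.
elim: k F => [//|k IH] F.
have DF : (forall x, U x -> differentiable F x) -> forall v i j x, U x ->
    'D_v F x i j = 'D_v (fun y => F y i j) x.
  by move=> dF v i j x Ux; rewrite derive_mx ?mxE//; exact/diff_derivable/dF.
split=> [[dF kF] i j|kF].
  split=> [x Ux|v]; first by have/differentiable_mxP := dF _ Ux.
  by apply: (ndiff_eq oU (DF dF v i j)); have /IH := kF v; exact.
have dF x : U x -> differentiable F x.
  move=> Ux; apply/differentiable_mxP => i j.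
  by have [+ _] := kF i j; exact.
split=> // v; apply/IH => i j.
apply: (ndiff_eq oU (f := 'D_v (fun y => F y i j))); last first.
  by have [_ +] := kF i j; exact.
by move=> x Ux; rewrite DF.
Qed.

End Scalar.

Lemma derive_row n (W : normedModType R) (h : 'rV[R]_n -> W) x v :
  differentiable h x ->
  'D_v h x = \sum_(i < n) v 0 i *: 'D_('e_i) h x.
Proof.
move=> dh; rewrite deriveE// {1}(row_sum_delta v) linear_sum.
by apply: eq_bigr => i _; rewrite linearZ /= deriveE.
Qed.

Lemma derive_comp (V V' W : normedModType R) (g : V -> V') (h : V' -> W) x v :
  differentiable g x -> differentiable h (g x) ->
  'D_v (h \o g) x = 'D_('D_v g x) h (g x).
Proof.
move=> dg dh; rewrite !deriveE//; last exact: differentiable_comp.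
by rewrite diff_comp.
Qed.

Lemma ndiff_comp k (V : normedModType R) n (U : set V) (A : set 'rV[R]_n)
    (g : V -> 'rV[R]_n) (h : 'rV[R]_n -> R) :
  open U -> (forall x, U x -> A (g x)) ->
  ndifferentiable_on k U g -> ndifferentiable_on k A h ->
  ndifferentiable_on k U (h \o g).
Proof.
move=> oU UA; elim: k h => [//|k IH] h kg kh.
have [[dg Dg] [dh Dh]] := (kg, kh); split=> [x Ux|v].
  by apply: differentiable_comp; [exact: dg|exact/dh/UA].
apply: (ndiff_eq oU (f := fun x =>
    \sum_(i < n) ('D_v g x 0 i) * ('D_('e_i) h \o g) x)).
  move=> x Ux; have dgx := dg x Ux; have dhx := dh _ (UA x Ux).
  by rewrite (derive_comp v dgx dhx) (derive_row _ dhx).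
apply: (ndiff_sum oU) => i; apply: (ndiffM oU).
  exact: (ndiff_mxP oU _ _).1 (Dg v) 0 i.
by apply: IH; [exact: ndiffS|exact: Dh].
Qed.

Lemma ndiff_local k (V W : normedModType R) (U : set V) (f : V -> W) :
  (forall x, U x -> exists A, [/\ open A, A x & ndifferentiable_on k A f]) ->
  ndifferentiable_on k U f.
Proof.
elim: k f => [//|k IH] f loc; split=> [x Ux|v].
  by have [A [_ Ax [dA _]]] := loc x Ux; exact: dA.
apply: IH => x Ux; have [A [oA Ax [_ DA]]] := loc x Ux.
by exists A; split=> //; exact: DA.
Qed.

Lemma ndiff_sub k (V W : normedModType R) (U A : set V) (f : V -> W) :
  U `<=` A -> ndifferentiable_on k A f -> ndifferentiable_on k U f.
Proof.
move=> UA; elim: k f => [//|k IH] f [df Df]; split=> [x /UA|v]; first exact: df.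
by apply: IH; exact: Df.
Qed.

End SmoothCalculus.

(* cinv is a total function; only its values on cmap @` cdom, where it is the
   inverse of cmap, are constrained (see is_chart) *)
Record chart (R : realType) (n : nat) (M : topologicalType) := Chart {
  cdom : set M;
  cmap : M -> 'rV[R]_n;
  cinv : 'rV[R]_n -> M }.

Definition is_chart (R : realType) (n : nat) (M : topologicalType)
    (c : chart R n M) :=
  [/\ open (cdom c), open (cmap c @` cdom c),
      forall x, cdom c x -> cinv c (cmap c x) = x,
      forall x, cdom c x -> {for x, continuous (cmap c)} &
      forall y, (cmap c @` cdom c) y -> {for y, continuous (cinv c)}].

(* The atlas need not be maximal. chart_at is a preferred chart around each
   point, used to represent the tangent spaces. *)
Record manifold (R : realType) := Manifold {
  points :> topologicalType;
  mdim : nat;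
  atlas : set (chart R mdim points);
  chart_at : points -> chart R mdim points;
  manifold_hausdorff : hausdorff_space points;
  manifold_second_countable : @second_countable points;
  atlas_chart : forall c, atlas c -> is_chart c;
  atlas_compat : forall c c', atlas c -> atlas c' ->
    smooth_on (cmap c @` (cdom c `&` cdom c')) (cmap c' \o cinv c);
  atlas_chart_at : forall x, atlas (chart_at x);
  cdom_chart_at : forall x, cdom (chart_at x) x }.

Definition msmooth (R : realType) (M : manifold R) (W : normedModType R)
    (A : set M) (f : M -> W) :=
  forall c, atlas c -> smooth_on (cmap c @` (A `&` cdom c)) (f \o cinv c).

Section ManifoldTheory.
Context {R : realType} {M : manifold R}.
Implicit Types (A B : set M).

Lemma open_cdom c : @atlas R M c -> open (cdom c).
Proof. by case/atlas_chart. Qed.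

Lemma cmapK c x : @atlas R M c -> cdom c x -> cinv c (cmap c x) = x.
Proof. by case/atlas_chart => _ _ + _ _; exact. Qed.

Lemma open_cimage c A : @atlas R M c -> open A ->
  open (cmap c @` (A `&` cdom c)).
Proof.
move=> /[dup] ac /atlas_chart[_ oim _ _ cinvc] oA.
rewrite openE => _ [x [Ax cx] <-].
have imx : (cmap c @` cdom c) (cmap c x) by exists x.
have n1 : \forall y \near cmap c x, (cmap c @` cdom c) y.
  exact: open_nbhs_nbhs (conj oim imx).
have n2 : \forall y \near cmap c x, A (cinv c y).
  apply: (cinvc _ imx); rewrite /= cmapK//; exact: open_nbhs_nbhs (conj oA Ax).
near=> y.
have [z cz zy] : (cmap c @` cdom c) y by near: y.
have : A (cinv c y) by near: y.
by rewrite -zy cmapK// => Az; exists z.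
Unshelve. all: by end_near. Qed.

Lemma msmooth_eq (W : normedModType R) A (f g : M -> W) : open A ->
  (forall x, A x -> f x = g x) -> msmooth A f -> msmooth A g.
Proof.
move=> oA fg sf c ac k; apply: ndiff_eq (sf c ac k); first exact: open_cimage.
by move=> _ [x [Ax cx] <-] /=; rewrite cmapK// fg.
Qed.

Lemma msmooth_sub (W : normedModType R) A B (f : M -> W) :
  A `<=` B -> msmooth B f -> msmooth A f.
Proof.
move=> AB sf c ac k; apply: ndiff_sub (sf c ac k).
by move=> _ [x [/AB Bx cx] <-]; exists x.
Qed.

Lemma msmooth_local (W : normedModType R) A (f : M -> W) :
  (forall x, A x -> exists B, [/\ open B, B x & msmooth B f]) -> msmooth A f.
Proof.
move=> loc c ac k; apply: ndiff_local => _ [x [Ax cx] <-].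
have [B [oB Bx sB]] := loc x Ax; exists (cmap c @` (B `&` cdom c)).
split; [exact: open_cimage|by exists x|exact: sB].
Qed.

Lemma msmooth_cst (W : normedModType R) A (w : W) : open A -> msmooth A (cst w).
Proof. by move=> oA c ac k; apply: ndiff_cst; exact: open_cimage. Qed.

Lemma msmoothD (W : normedModType R) A (f g : M -> W) : open A ->
  msmooth A f -> msmooth A g -> msmooth A (f \+ g).
Proof.
move=> oA sf sg c ac k; apply: (ndiffD _ (f := f \o cinv c) (g := g \o cinv c)).
- exact: open_cimage.
- exact: sf.
- exact: sg.
Qed.

Lemma msmooth_sum (W : normedModType R) n A (f : 'I_n -> M -> W) : open A ->
  (forall i, msmooth A (f i)) -> msmooth A (fun x => \sum_(i < n) f i x).
Proof.
move=> oA sf c ac k; apply: (ndiff_sum _ (f := fun i => f i \o cinv c)).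
  exact: open_cimage.
by move=> i; exact: sf.
Qed.

Lemma msmoothM A (f g : M -> R) : open A ->
  msmooth A f -> msmooth A g -> msmooth A (f \* g).
Proof.
move=> oA sf sg c ac k; apply: (ndiffM _ (f := f \o cinv c) (g := g \o cinv c)).
- exact: open_cimage.
- exact: sf.
- exact: sg.
Qed.

Lemma msmooth_mxP m n A (F : M -> 'M[R]_(m, n)) : open A ->
  msmooth A F <-> forall i j, msmooth A (fun x => F x i j).
Proof.
move=> oA; split=> [sF i j c ac k|sF c ac k].
  exact: (ndiff_mxP (open_cimage ac oA) _ _).1 (sF c ac k) i j.
apply/(ndiff_mxP (open_cimage ac oA)) => i j; exact: sF.
Qed.

Lemma msmooth_mulmx m n p A (F : M -> 'M[R]_(m, n)) (G : M -> 'M[R]_(n, p)) :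
  open A -> msmooth A F -> msmooth A G -> msmooth A (fun x => F x *m G x).
Proof.
move=> oA /(msmooth_mxP _ oA) sF /(msmooth_mxP _ oA) sG.
apply/(msmooth_mxP _ oA) => i j.
rewrite (_ : (fun _ => _) = fun x => \sum_(k < n) (F x i k * G x k j)).
  by apply: msmooth_sum => // k; exact: msmoothM.
by apply/funext => x; rewrite mxE.
Qed.

Lemma msmooth_trmx m n A (F : M -> 'M[R]_(m, n)) :
  open A -> msmooth A F -> msmooth A (fun x => (F x)^T).
Proof.
move=> oA /(msmooth_mxP _ oA) sF; apply/(msmooth_mxP _ oA) => i j.
rewrite (_ : (fun _ => _) = fun x => F x j i); first exact: sF.
by apply/funext => x; rewrite mxE.
Qed.

Lemma msmooth_scalemx m n A (f : M -> R) (F : M -> 'M[R]_(m, n)) :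
  open A -> msmooth A f -> msmooth A F -> msmooth A (fun x => f x *: F x).
Proof.
move=> oA sf /(msmooth_mxP _ oA) sF; apply/(msmooth_mxP _ oA) => i j.
rewrite (_ : (fun _ => _) = fun x => f x * F x i j); first exact: msmoothM.
by apply/funext => x; rewrite mxE.
Qed.

End ManifoldTheory.

(* A vector bundle is presented by its fibres and a family of local
   trivializations, linear isomorphisms on fibres, whose transition matrices
   are smooth; these data determine the smooth structure of the total space.
   Row-vector convention: the transition matrices act on the right. *)
Record local_triv (R : realType) (M : manifold R) (E : M -> lmodType R)
    (r : nat) := LocalTriv {
  tdom : set M;
  tmap : forall x, E x -> 'rV[R]_r }.
Arguments tmap {R M E r} t x v : rename.

Record vbundle (R : realType) (M : manifold R) := VBundle {
  fibre :> M -> lmodType R;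
  rank : nat;
  trivs : set (local_triv fibre rank);
  triv_open : forall t, trivs t -> open (tdom t);
  triv_cover : forall x, exists2 t, trivs t & tdom t x;
  triv_linear : forall t x, trivs t -> tdom t x -> linear (tmap t x);
  triv_bij : forall t x, trivs t -> tdom t x -> bijective (tmap t x);
  triv_trans : forall t t', trivs t -> trivs t' ->
    exists2 A : M -> 'M[R]_rank, msmooth (tdom t `&` tdom t') A &
      forall x v, tdom t x -> tdom t' x -> tmap t' x v = tmap t x v *m A x }.

Section TangentBundle.
Context {R : realType} (M : manifold R).

(* T_xM is represented by R^n through the preferred chart at x: v stands for the
   velocity whose coordinates in that chart are v. The coordinates of v in
   another chart c are then given by the differential of the change of charts,
   which is the trivialization of TM attached to c. *)
Definition tangent_triv (c : chart R (mdim M) M) :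
    local_triv (fun _ : M => 'rV[R]_(mdim M)) (mdim M) :=
  @LocalTriv R M (fun _ => 'rV[R]_(mdim M)) (mdim M) (cdom c)
    (fun x v => 'D_v (cmap c \o cinv (chart_at x)) (cmap (chart_at x) x)).

Definition tangent_trivs := [set tangent_triv c | c in @atlas R M].

Lemma open_overlap (c c' : chart R (mdim M) M) : atlas c -> atlas c' ->
  open (cmap c @` (cdom c `&` cdom c')).
Proof.
by move=> ac ac'; rewrite setIC; apply: open_cimage => //; exact: open_cdom.
Qed.

Lemma differentiable_transition (c c' : chart R (mdim M) M) x :
  atlas c -> atlas c' -> cdom c x -> cdom c' x ->
  differentiable (cmap c' \o cinv c) (cmap c x).
Proof.
move=> ac ac' cx cx'; have [+ _] := atlas_compat ac ac' 1; apply.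
by exists x.
Qed.

Lemma derive_transition (W : normedModType R) (c c' : chart R (mdim M) M)
    (f : M -> W) x v :
  atlas c -> atlas c' -> cdom c x -> cdom c' x ->
  differentiable (f \o cinv c') (cmap c' x) ->
  'D_v (f \o cinv c) (cmap c x) =
  'D_('D_v (cmap c' \o cinv c) (cmap c x)) (f \o cinv c') (cmap c' x).
Proof.
move=> ac ac' cx cx' df.
have xE : (cmap c' \o cinv c) (cmap c x) = cmap c' x by rewrite /= cmapK.
rewrite -xE -derive_comp ?xE//; last exact: differentiable_transition.
apply: near_eq_derive; apply: (open_near (open_overlap ac ac')); last by exists x.
by move=> _ [y [cy c'y] <-] /=; rewrite !cmapK.
Qed.

Lemma differentiable_change (W : normedModType R) (c c' : chart R (mdim M) M)
    (f : M -> W) x :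
  atlas c -> atlas c' -> cdom c x -> cdom c' x ->
  differentiable (f \o cinv c') (cmap c' x) ->
  differentiable (f \o cinv c) (cmap c x).
Proof.
move=> ac ac' cx cx' df.
have xE : (cmap c' \o cinv c) (cmap c x) = cmap c' x by rewrite /= cmapK.
have : differentiable ((f \o cinv c') \o (cmap c' \o cinv c)) (cmap c x).
  by apply: differentiable_comp; rewrite ?xE//; exact: differentiable_transition.
apply: near_eq_differentiable.
apply: (open_near (open_overlap ac ac')); last by exists x.
by move=> _ [y [cy c'y] <-] /=; rewrite !cmapK.
Qed.

Fact tangent_triv_open t : tangent_trivs t -> open (tdom t).
Proof. by move=> [c ac <-]; exact: open_cdom. Qed.

Fact tangent_triv_cover x : exists2 t, tangent_trivs t & tdom t x.
Proof.
exists (tangent_triv (chart_at x)); last exact: cdom_chart_at.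
by exists (chart_at x) => //; exact: atlas_chart_at.
Qed.

Fact tangent_triv_linear t x :
  tangent_trivs t -> tdom t x -> linear (tmap t x).
Proof.
move=> [c ac <-] /= cx a u v.
have d : differentiable (cmap c \o cinv (chart_at x)) (cmap (chart_at x) x).
  by apply: differentiable_transition => //;
    [exact: atlas_chart_at|exact: cdom_chart_at].
by rewrite !deriveE// linearP.
Qed.

Lemma derive_transitionK (c c' : chart R (mdim M) M) x v :
  atlas c -> atlas c' -> cdom c x -> cdom c' x ->
  'D_('D_v (cmap c' \o cinv c) (cmap c x)) (cmap c \o cinv c') (cmap c' x) = v.
Proof.
move=> ac ac' cx cx'; rewrite -derive_transition//; last first.
  exact: differentiable_transition.
rewrite (@near_eq_derive _ _ _ _ id) ?derive_id//.
apply: (open_near (open_overlap ac ac')); last by exists x.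
by move=> _ [y [cy c'y] <-] /=; rewrite cmapK.
Qed.

Fact tangent_triv_bij t x :
  tangent_trivs t -> tdom t x -> bijective (tmap t x).
Proof.
move=> [c ac <-] /= cx; have ax := atlas_chart_at x; have dx := cdom_chart_at x.
exists (fun v => 'D_v (cmap (chart_at x) \o cinv c) (cmap c x)) => v.
  exact: derive_transitionK.
exact: derive_transitionK.
Qed.

Fact tangent_triv_trans t t' : tangent_trivs t -> tangent_trivs t' ->
  exists2 A : M -> 'M[R]_(mdim M), msmooth (tdom t `&` tdom t') A &
    forall x v, tdom t x -> tdom t' x -> tmap t' x v = tmap t x v *m A x.
Proof.
move=> [c ac <-] [c' ac' <-] /=.
pose J := fun y => \matrix_(i, j) ('D_('e_i) (cmap c' \o cinv c) y) 0 j.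
have oc := open_cdom ac; have oc' := open_cdom ac'.
exists (fun x => J (cmap c x)).
  apply/msmooth_mxP; first exact: openI.
  move=> i j d ad k.
  rewrite (_ : _ \o _ = (fun y => J y i j) \o (cmap c \o cinv d))//.
  apply: (@ndiff_comp _ _ _ _ _ (cmap c @` (cdom c `&` cdom c'))).
  - by apply: open_cimage => //; exact: openI.
  - by move=> _ [x [[cx c'x] dx] <-]; rewrite /= cmapK//; exists x.
  - apply: ndiff_sub (atlas_compat ad ac k).
    by move=> _ [x [[cx c'x] dx] <-]; exists x.
  - have [_ /(_ 'e_i)] := atlas_compat ac ac' k.+1.
    move=> /(ndiff_mxP (open_overlap ac ac'))/(_ 0 j).
    by apply: ndiff_eq; [exact: open_overlap|move=> y _; rewrite mxE].
move=> x v /= cx c'x.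
have ax := atlas_chart_at x; have dx := cdom_chart_at x.
rewrite (derive_transition _ ax ac)//; last exact: differentiable_transition.
rewrite derive_row; last exact: differentiable_transition.
apply/rowP => j; rewrite summxE !mxE; apply: eq_bigr => i _.
by rewrite !mxE.
Qed.

Definition tangent_bundle : vbundle M :=
  VBundle tangent_triv_open tangent_triv_cover tangent_triv_linear
    tangent_triv_bij tangent_triv_trans.

End TangentBundle.

(* Gamma(E) *)
Record sections (R : realType) (M : manifold R) (E : vbundle M) := SmoothSection {
  sec_fun :> forall x : M, E x;
  sec_smooth : forall t, trivs t ->
    msmooth (tdom t) (fun x => tmap t x (sec_fun x)) }.

(* C^oo(M) *)
Record smooth_fun (R : realType) (M : manifold R) := SmoothFun {
  sfun_fun :> M -> R;
  sfun_smooth : msmooth setT sfun_fun }.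

(* a bundle map over the identity of M, smooth in local trivializations *)
Record bundle_map (R : realType) (M : manifold R) (E F : vbundle M) := BundleMap {
  bmap_fun :> forall x, {linear E x -> F x};
  bmap_smooth : forall t t', trivs t -> trivs t' ->
    exists2 A : M -> 'M[R]_(rank E, rank F), msmooth (tdom t `&` tdom t') A &
      forall x v, tdom t x -> tdom t' x ->
        tmap t' x (bmap_fun x v) = tmap t x v *m A x }.

(* a smooth section of E^* (x) E^*; G is the Gram matrix in a trivialization *)
Record bilinear_form (R : realType) (M : manifold R) (E : vbundle M) := BilinearForm {
  form_fun :> forall x, E x -> E x -> R;
  form_linearl : forall x (v : E x), linear_for *%R (fun u => form_fun u v);
  form_linearr : forall x (u : E x), linear_for *%R (form_fun u);
  form_smooth : forall t, trivs t ->
    exists2 G : M -> 'M[R]_(rank E), msmooth (tdom t) G &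
      forall x (u v : E x), tdom t x ->
        form_fun u v = (tmap t x u *m G x *m (tmap t x v)^T) 0 0 }.
Arguments form_fun {R M E} b x u v : rename.

Section SmoothFunctions.
Context {R : realType} {M : manifold R}.
Implicit Types f g h : smooth_fun M.

Lemma smooth_fun_eq f g : (forall x, f x = g x) -> f = g.
Proof.
case: f g => [f sf] [g sg] /= fg; have {}fg : f = g by apply/funext.
by case: _ / fg in sg *; congr SmoothFun; exact: Prop_irrelevance.
Qed.

Fact smooth_fun_zero_smooth : msmooth setT (cst 0 : M -> R).
Proof. by apply: msmooth_cst; exact: openT. Qed.

Fact smooth_fun_add_smooth f g : msmooth setT (fun x => f x + g x).
Proof. by apply: msmoothD; [exact: openT|exact: sfun_smooth..]. Qed.

Fact smooth_fun_scale_smooth (a : R) f : msmooth setT (fun x => a * f x).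
Proof.
apply: (msmoothM (f := cst a)); [exact: openT| |exact: sfun_smooth].
by apply: msmooth_cst; exact: openT.
Qed.

Fact smooth_fun_opp_smooth f : msmooth setT (fun x => - f x).
Proof.
rewrite (_ : (fun _ => _) = fun x => -1 * f x); first exact: smooth_fun_scale_smooth.
by apply/funext => x; rewrite mulN1r.
Qed.

HB.instance Definition _ := gen_eqMixin (smooth_fun M).
HB.instance Definition _ := gen_choiceMixin (smooth_fun M).

Let zerof := SmoothFun smooth_fun_zero_smooth.
Let addf f g := SmoothFun (smooth_fun_add_smooth f g).
Let oppf f := SmoothFun (smooth_fun_opp_smooth f).
Let scalef (a : R) f := SmoothFun (smooth_fun_scale_smooth a f).

Fact addfA : associative addf.
Proof. by move=> f g h; apply: smooth_fun_eq => x /=; rewrite addrA. Qed.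
Fact addfC : commutative addf.
Proof. by move=> f g; apply: smooth_fun_eq => x /=; rewrite addrC. Qed.
Fact add0f : left_id zerof addf.
Proof. by move=> f; apply: smooth_fun_eq => x /=; rewrite add0r. Qed.
Fact addNf : left_inverse zerof oppf addf.
Proof. by move=> f; apply: smooth_fun_eq => x /=; rewrite addNr. Qed.

HB.instance Definition _ :=
  GRing.isZmodule.Build (smooth_fun M) addfA addfC add0f addNf.

Fact scalefA (a b : R) f : scalef a (scalef b f) = scalef (a * b) f.
Proof. by apply: smooth_fun_eq => x /=; rewrite mulrA. Qed.
Fact scale1f : left_id 1 scalef.
Proof. by move=> f; apply: smooth_fun_eq => x /=; rewrite mul1r. Qed.
Fact scalefDr : right_distributive scalef +%R.
Proof. by move=> a f g; apply: smooth_fun_eq => x /=; rewrite mulrDr. Qed.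
Fact scalefDl f : {morph scalef^~ f : a b / a + b}.
Proof. by move=> a b; apply: smooth_fun_eq => x /=; rewrite mulrDl. Qed.

HB.instance Definition _ := GRing.Zmodule_isLmodule.Build R (smooth_fun M)
  scalefA scale1f scalefDr scalefDl.

End SmoothFunctions.

Section Sections.
Context {R : realType} {M : manifold R} {E : vbundle M}.
Implicit Types s u v : sections E.

Lemma sections_eq s u : (forall x, s x = u x) -> s = u.
Proof.
case: s u => [s ss] [u su] /= e.
have {}e : s = u by apply: functional_extensionality_dep.
by case: _ / e in su *; congr SmoothSection; exact: Prop_irrelevance.
Qed.

Let tlin (t : local_triv E (rank E)) x (a : R) (p q : E x) : trivs t -> tdom t x ->
  tmap t x (a *: p + q) = a *: tmap t x p + tmap t x q.
Proof. by move=> tt tx; exact: triv_linear. Qed.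

Fact section_mul_smooth (f : smooth_fun M) s t : trivs t ->
  msmooth (tdom t) (fun x => tmap t x (f x *: s x)).
Proof.
move=> tt; have ot := triv_open tt.
apply: (msmooth_eq (f := fun x => f x *: tmap t x (s x))) => //.
  by move=> x tx; have L := triv_linear tt tx; rewrite (scalable_linear L).
apply: msmooth_scalemx => //; last exact: sec_smooth.
by apply: msmooth_sub (sfun_smooth f).
Qed.

Fact section_lin_smooth (a : R) s u t : trivs t ->
  msmooth (tdom t) (fun x => tmap t x (a *: s x + u x)).
Proof.
move=> tt; have ot := triv_open tt.
apply: (msmooth_eq (f := fun x => a *: tmap t x (s x) + tmap t x (u x))) => //.
  by move=> x tx; rewrite tlin.
apply: (msmoothD (f := fun x => a *: tmap t x (s x))) => //; last exact: sec_smooth.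
apply: (msmooth_scalemx (f := cst a)) => //; last exact: sec_smooth.
exact: msmooth_cst.
Qed.

Fact section_zero_smooth t : @trivs R M E t ->
  msmooth (tdom t) (fun x => tmap t x (0 : E x)).
Proof.
move=> tt; have ot := triv_open tt.
apply: (msmooth_eq (f := cst 0)) => //; last exact: msmooth_cst.
by move=> x tx; have := tlin (-1) 0 0 tt tx; rewrite scaleN1r addNr scaleN1r addNr.
Qed.

Fact section_add_smooth s u t : trivs t ->
  msmooth (tdom t) (fun x => tmap t x (s x + u x)).
Proof.
move=> tt; have := section_lin_smooth 1 s u tt.
by apply: msmooth_eq => [|x tx]; [exact: triv_open|rewrite scale1r].
Qed.

Fact section_scale_smooth (a : R) s t : trivs t ->
  msmooth (tdom t) (fun x => tmap t x (a *: s x)).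
Proof.
move=> tt; have := section_lin_smooth a s (SmoothSection section_zero_smooth) tt.
by apply: msmooth_eq => [|x tx]; [exact: triv_open|rewrite /= addr0].
Qed.

Fact section_opp_smooth s t : trivs t ->
  msmooth (tdom t) (fun x => tmap t x (- s x)).
Proof.
move=> tt; have := section_scale_smooth (-1) s tt.
by apply: msmooth_eq => [|x tx]; [exact: triv_open|rewrite /= scaleN1r].
Qed.

HB.instance Definition _ := gen_eqMixin (sections E).
HB.instance Definition _ := gen_choiceMixin (sections E).

Let zeros := SmoothSection section_zero_smooth.
Let adds s u := SmoothSection (section_add_smooth s u).
Let opps s := SmoothSection (section_opp_smooth s).
Let scales (a : R) s := SmoothSection (section_scale_smooth a s).

Fact addsA : associative adds.
Proof. by move=> s u v; apply: sections_eq => x /=; rewrite addrA. Qed.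
Fact addsC : commutative adds.
Proof. by move=> s u; apply: sections_eq => x /=; rewrite addrC. Qed.
Fact add0s : left_id zeros adds.
Proof. by move=> s; apply: sections_eq => x /=; rewrite add0r. Qed.
Fact addNs : left_inverse zeros opps adds.
Proof. by move=> s; apply: sections_eq => x /=; rewrite addNr. Qed.

HB.instance Definition _ :=
  GRing.isZmodule.Build (sections E) addsA addsC add0s addNs.

Fact scalesA (a b : R) s : scales a (scales b s) = scales (a * b) s.
Proof. by apply: sections_eq => x /=; rewrite scalerA. Qed.
Fact scale1s : left_id 1 scales.
Proof. by move=> s; apply: sections_eq => x /=; rewrite scale1r. Qed.
Fact scalesDr : right_distributive scales +%R.
Proof. by move=> a s u; apply: sections_eq => x /=; rewrite scalerDr. Qed.
Fact scalesDl s : {morph scales^~ s : a b / a + b}.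
Proof. by move=> a b; apply: sections_eq => x /=; rewrite scalerDl. Qed.

HB.instance Definition _ := GRing.Zmodule_isLmodule.Build R (sections E)
  scalesA scale1s scalesDr scalesDl.

Definition section_mul (f : smooth_fun M) s : sections E :=
  SmoothSection (section_mul_smooth f s).

Fact form_eval_smooth (w : bilinear_form E) s u :
  msmooth setT (fun x => w x (s x) (u x)).
Proof.
apply: msmooth_local => x _; have [t tt tx] := triv_cover E x.
have ot := triv_open tt; exists (tdom t); split=> //.
have [G sG wG] := form_smooth w tt.
apply: (msmooth_eq (f := fun x => (tmap t x (s x) *m G x *m (tmap t x (u x))^T) 0 0)) => //.
  by move=> y ty; rewrite wG.
apply: (msmooth_mxP (fun x => tmap t x (s x) *m G x *m (tmap t x (u x))^T) ot).1.
apply: msmooth_mulmx => //; last by apply: msmooth_trmx => //; exact: sec_smooth.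
by apply: msmooth_mulmx => //; exact: sec_smooth.
Qed.

Definition form_eval (w : bilinear_form E) s u : smooth_fun M :=
  SmoothFun (form_eval_smooth w s u).

Fact bmap_section_smooth (F : vbundle M) (phi : bundle_map E F) s t : trivs t ->
  msmooth (tdom t) (fun x => tmap t x (phi x (s x))).
Proof.
move=> tt; apply: msmooth_local => x tx; have [t' tt' tx'] := triv_cover E x.
have ot := triv_open tt; have ot' := triv_open tt'.
have oI := openI ot' ot; exists (tdom t' `&` tdom t); split=> //.
have [A sA phiA] := bmap_smooth phi tt' tt.
apply: (msmooth_eq (f := fun x => tmap t' x (s x) *m A x)) => //.
  by move=> y [ty' ty]; rewrite phiA.
apply: msmooth_mulmx => //.
by apply: msmooth_sub (sec_smooth s tt') => y [].
Qed.

Definition bmap_section (F : vbundle M) (phi : bundle_map E F) s : sections F :=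
  SmoothSection (bmap_section_smooth phi s).

End Sections.

Section VectorFields.
Context {R : realType} {M : manifold R}.

(* v(f), for v in T_xM: the directional derivative in the preferred chart at x,
   by which v is represented; derive_transition gives it in any chart *)
Definition tangent_derive (x : M) (v : tangent_bundle M x) (f : M -> R) : R :=
  'D_(v : 'rV[R]_(mdim M)) (f \o cinv (chart_at x)) (cmap (chart_at x) x).

Fact vector_field_derive_smooth (X : sections (tangent_bundle M)) (f : smooth_fun M) :
  msmooth setT (fun x => tangent_derive (X x) f).
Proof.
apply: msmooth_local => x _; set c := chart_at x.
have ac : atlas c by exact: atlas_chart_at.
have cx : cdom c x by exact: cdom_chart_at.
have oc := open_cdom ac; exists (cdom c); split=> //.
have tc : @trivs R M (tangent_bundle M) (tangent_triv c) by exists c.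
have sX := sec_smooth X tc.
have df y : cdom c y -> differentiable (f \o cinv c) (cmap c y).
  by move=> cy; have [+ _] := sfun_smooth f ac 1; apply; exists y.
pose g y := \sum_(i < mdim M) (tmap (tangent_triv c) y (X y) 0 i *
    ('D_('e_i) (f \o cinv c) \o cmap c) y).
apply: (msmooth_eq (f := g)) => //.
  move=> y cy; rewrite /tangent_derive (derive_transition (c' := c))//.
  - by rewrite derive_row//; exact: df.
  - exact: atlas_chart_at.
  - exact: cdom_chart_at.
  - exact: df.
apply: msmooth_sum => // i; apply: (msmoothM (f := fun y => tmap (tangent_triv c) y (X y) 0 i)) => //.
  exact: (msmooth_mxP _ oc).1.
move=> d ad k; apply: (@ndiff_comp _ _ _ _ _ (cmap c @` (setT `&` cdom c)) (cmap c \o cinv d) ('D_('e_i) (f \o cinv c))).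
- exact: open_cimage.
- by move=> _ [y [cy dy] <-]; rewrite /= cmapK//; exists y.
- apply: ndiff_sub (atlas_compat ad ac k).
  by move=> _ [y [cy dy] <-]; exists y.
- by have [_ +] := sfun_smooth f ac k.+1; exact.
Qed.

Definition vector_field_derive (X : sections (tangent_bundle M)) (f : smooth_fun M) :
  smooth_fun M := SmoothFun (vector_field_derive_smooth X f).

End VectorFields.

Section Algebroids.
Context {R : realType} {M : manifold R} (E : vbundle M).
Implicit Types (e x y z : sections E) (f g : smooth_fun M).
Variables (br star : sections E -> sections E -> sections E).
Variables (rho : bundle_map E (tangent_bundle M)) (w : bilinear_form E).

(* rho(e)(f) *)
Definition anchor_derive e f : smooth_fun M :=
  vector_field_derive (bmap_section rho e) f.

Local Notation "''L_' x" := (anchor_derive x)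
  (at level 8, x at level 2, format "''L_' x").
Local Notation "''w' ( x , y )" := (form_eval w x y)
  (at level 8, format "''w' ( x ,  y )").

Definition skew_form := forall (p : M) (u v : E p), w p u v = - w p v u.

Definition nondegenerate_form :=
  forall (p : M) (u : E p), (forall v, w p u v = 0) -> u = 0.

Record is_lie_algebroid : Prop := IsLieAlgebroid {
  bracket_linearl : forall e, linear (br^~ e);
  bracket_linearr : forall e, linear (br e);
  bracket_alternating : forall e, br e e = 0;
  bracket_jacobi : forall e1 e2 e3,
    br e1 (br e2 e3) + br e2 (br e3 e1) + br e3 (br e1 e2) = 0;
  bracket_leibniz : forall e1 e2 f,
    br e1 (section_mul f e2) =
    section_mul f (br e1 e2) + section_mul ('L_e1 f) e2 }.

Record is_symplectic_lie_algebroid : Prop := IsSymplecticLieAlgebroid {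
  symplectic_lie_algebroid : is_lie_algebroid;
  symplectic_skew : skew_form;
  symplectic_nondegenerate : nondegenerate_form;
  symplectic_closed : forall x y z,
    'L_x 'w(y, z) - 'L_y 'w(x, z) + 'L_z 'w(x, y)
    - 'w(br x y, z) + 'w(br x z, y) - 'w(br y z, x) = 0 }.

Definition is_symplectic_product := forall e1 e2 e3,
  'w(star e1 e2, e3) =
  'L_e1 'w(e2, e3) + 2^-1 *: 'L_e3 'w(e1, e2) - 'w(e2, br e1 e3).

Definition associator e1 e2 e3 := star e1 (star e2 e3) - star (star e1 e2) e3.

Definition commutator e1 e2 := star e1 e2 - star e2 e1.

Definition star_T e1 e2 e3 : smooth_fun M :=
  'w(star e1 e2, e3) + 'w(e1, star e2 e3)
  - 'w(star e2 e1, e3) - 'w(e2, star e1 e3).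

Definition is_anchor_gradient (D : smooth_fun M -> sections E) :=
  forall f e, 'w(D f, e) = 'L_e f.

(* D is uniquely determined by is_anchor_gradient, w being nondegenerate *)
Record is_presymplectic_algebroid : Prop := IsPresymplecticAlgebroid {
  presymplectic_skew : skew_form;
  presymplectic_nondegenerate : nondegenerate_form;
  product_linearl : forall e, linear (star^~ e);
  product_linearr : forall e, linear (star e);
  presymplectic_axioms : exists D : smooth_fun M -> sections E,
    [/\ is_anchor_gradient D,
        forall e1 e2 e3, associator e1 e2 e3 - associator e2 e1 e3 =
          6^-1 *: D (star_T e1 e2 e3) &
        forall e1 e2 e3, 'L_e1 'w(e2, e3) =
          'w(star e1 e2 - 2^-1 *: D 'w(e1, e2), e3) + 'w(e2, commutator e1 e3)] }.

End Algebroids.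

(* Main.v *)
Require Import Defs.
From mathcomp Require Import all_boot all_order all_algebra.
From mathcomp Require Import ring lra.
From mathcomp Require Import all_classical all_reals interval_inference.
From mathcomp Require Import topology normedtype derive realfun.
From mathcomp Require Import sequences exp.
Import Order.TTheory GRing.Theory Num.Theory.
Import numFieldNormedType.Exports.

Set Implicit Arguments.
Unset Strict Implicit.
Unset Printing Implicit Defensive.

Local Open Scope classical_set_scope.
Local Open Scope ring_scope.

(** Write L_x f for rho(x)(f), D f for the gradient of f, and A_x y for the
    section that represents the 1-form L_x (w(y, -)), the Lie derivative along x
    of the 1-form attached to y: w(A_x y, z) = L_x w(y, z) - w(y, [x, z]). The
    equation that defines the product says
                  x * y = A_x y + 1/2 D w(x, y)
    ([symplectic_productP]). The theorem then rests on the usual calculus of Lie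
    derivatives: L_[x,y] = [L_x, L_y] on functions ([anchor_bracket]), hence
    A_[x,y] = [A_x, A_y] ([lie_derivative_bracket]); A_x (D f) = D (L_x f)
    ([lie_derivative_gradient]); and A_x y - A_y x = [x, y] - D w(x, y), which
    restates that w is closed ([lie_derivative_commutator]). The last identity
    gives the commutator of the product, and axiom (ii) follows from the
    definition of A. In axiom (i) the terms without D cancel because
    A_[x,y] = [A_x, A_y], and everything else is a gradient, which a direct
    computation identifies with D T / 6 ([star_associator]).

    The analytic content is that A and D exist. A functional on sections that is
    linear over the smooth functions must be represented by a smooth section
    through w ([riesz]). The Lie bracket is an operator on global sections, so
    its locality, and with it the locality of such functionals, comes from bump
    functions ([bump_function]); these also show that global sections take all
    values at each point ([section_through]), so that pairings with them
    separate sections ([form_eval_inj]). Bump functions are built from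
    exp(-1/t), and the smoothness of the representing section from that of the
    inverse of the Gram matrix of w in a trivialization ([msmooth_invmx]). *)

(** * A function flat at the origin *)

Section Flat.
Context {R : realType}.
Implicit Types (n : nat) (s t : R).

(** The powers of 1/t are part of the definition because differentiating
    exp(-1/t) produces them: the family indexed by n is closed under derivation
    up to linear combinations. *)
Definition flat n t : R := if 0 < t then t ^- n * expR (- t^-1) else 0.

(** Order two is what differentiability at 0 with zero derivative asks for; the
    bound is exp s >= s^(n+2) / (n+2)! at s = 1/t. *)
Lemma flat_le n t : `|flat n t| <= (n.+2)`!%:R * t ^+ 2.
Proof.
rewrite /flat; case: ifPn => [t0|_]; last first.
  by rewrite normr0 mulr_ge0 ?sqr_ge0.
have tn0 : t != 0 by rewrite gt_eqF.
rewrite ger0_norm; last by rewrite mulr_ge0 ?expR_ge0 ?invr_ge0 ?exprn_ge0 ?ltW.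
have := @expR_ge1Dxn R t^-1 n.+1.
rewrite invr_ge0 ltW// => /(_ isT) le.
have fn0 : (0 : R) < (n.+2)`!%:R by rewrite ltr0n fact_gt0.
rewrite expRN ler_pdivrMr ?expR_gt0//.
apply: le_trans (ler_wpM2l _ le); last by rewrite mulr_ge0 ?sqr_ge0// ltW.
have -> : t ^- n = (n.+2)`!%:R * t ^+ 2 * (t^-1 ^+ n.+2 / (n.+2)`!%:R).
  rewrite exprVn; move: (_`!%:R) fn0 => F F0.
  by rewrite -(add2n n) exprD; field; rewrite ?expf_neq0 ?(gt_eqF F0).
apply: ler_wpM2l; last by rewrite lerDr ler01.
by rewrite mulr_ge0 ?sqr_ge0 ?ler0n.
Qed.

Lemma is_derive_flat n t :
  is_derive t 1 (flat n) (flat n.+2 t - n%:R * flat n.+1 t).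
Proof.
have [t0|t0|->] := ltgtP t 0.
- rewrite {2 3}/flat !ltNge ltW//= mulr0 subr0.
  apply: (@near_eq_is_derive _ _ _ (cst 0)) => //.
  near=> s; rewrite /flat ltNge ltW//=.
  by near: s; exact: lt_nbhsl.
- rewrite {2 3}/flat t0; have tn0 : t != 0 by rewrite gt_eqF.
  apply: (@near_eq_is_derive _ _ _ ((fun s => s^-1) ^+ n * (fun s => expR (- s^-1)))) => //.
    near=> s; rewrite !fctE /flat ifT ?exprVn//.
    by near: s; exact: lt_nbhsr.
  have dV : is_derive t 1 (fun s : R => s^-1) (- t ^- 2).
    have := is_deriveV tn0 (is_derive_id t 1).
    by rewrite /GRing.scale /= mulr1.
  have dE : is_derive t 1 (fun s => expR (- s^-1)) (expR (- t^-1) * t ^- 2).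
    have := is_derive1_comp (f := expR) (g := fun s => - s^-1) (x := t).
    apply; rewrite -[X in is_derive _ _ _ X]opprK; exact: is_deriveN.
  have dX := is_deriveX n dV.
  apply: is_derive_eq (is_deriveM dX dE) _.
  rewrite /GRing.scale /= fctE; case: n {dX} => [|m].
    by field.
  rewrite !exprVn !exprS /=; have : t ^+ m != 0 by rewrite expf_neq0.
  move: (t ^+ m) (m.+1%:R) => T N T0; by field; rewrite T0.
- rewrite {2 3}/flat ltxx mulr0 subr0.

  have cv : h^-1 *: ((flat n \o shift 0) (h *: 1) - flat n 0) @[h --> 0^'] --> (0 : R).
    have C0 : (0 : R) < (n.+2)`!%:R by rewrite ltr0n fact_gt0.
    apply/cvgr0Pnorm_le => e e0.
    have d0 : 0 < e / (n.+2)`!%:R by rewrite divr_gt0.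
    near=> h.
    have h0 : h != 0 by near: h; exact: nbhs_dnbhs_neq.
    have hd : `|h| <= e / (n.+2)`!%:R.
      by near: h; apply: dnbhs0_le.
    rewrite /= addr0 /GRing.scale /= mulr1 [X in _ - X]/flat ltxx subr0.
    rewrite normrM normfV ler_pdivrMl ?normr_gt0//.
    apply: le_trans (flat_le n h) _.
    rewrite -[h ^+ 2]ger0_norm ?sqr_ge0// normrX expr2 mulrA mulrC.
    by rewrite ler_wpM2l// -ler_pdivlMl// mulrC.
  split; first by apply/cvg_ex; exists 0.
  exact: cvg_lim cv.
Unshelve. all: by end_near. Qed.

(** Induction on k, for all n at once: the derivative of flat n o f is D f times
    a combination of flat (n+2) o f and flat (n+1) o f. *)
Lemma ndiff_flat (V : normedModType R) (U : set V) (f : V -> R) n k :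
  open U -> ndifferentiable_on k U f ->
  ndifferentiable_on k U (flat n \o f).
Proof.
move=> oU; elim: k n => [//|k IH] n kf; have [df Df] := kf.
have dflat m t : differentiable (flat m) t.
  by apply/derivable1_diffP; by have [] := is_derive_flat m t.
split=> [x Ux|v]; first by apply: differentiable_comp; auto.
have kIH m : ndifferentiable_on k U (flat m \o f) by apply: IH; exact: ndiffS.
apply: (@ndiff_eq _ _ _ _ oU k
  ('D_v f \* (flat n.+2 \o f \+ (cst (- n%:R) \* (flat n.+1 \o f))))).
  move=> x Ux; rewrite derive_comp; auto.
  rewrite deriveE; auto.
  rewrite -[X in 'd _ _ X]mulr1 -[_ * 1]/(_ *: 1) linearZ /= -deriveE; auto.
  by have [_ ->] := is_derive_flat n (f x); rewrite /= mulNr.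
apply: (ndiffM oU); first exact: Df.
apply: (ndiffD oU); first exact: kIH.
by apply: (ndiffM oU); [exact: ndiff_cst|exact: kIH].
Qed.

End Flat.

Lemma ndiff_inv (R : realType) (V : normedModType R) (U : set V) (f : V -> R) k :
  open U -> (forall x, U x -> f x != 0) -> ndifferentiable_on k U f ->
  ndifferentiable_on k U (fun x => (f x)^-1).
Proof.
move=> oU f0; elim: k => [//|k IH] kf; have [df Df] := kf.
split=> [x Ux|v]; first by apply: differentiableV; auto.
have kIH := IH (ndiffS kf).
apply: (@ndiff_eq _ _ _ _ oU k
  (cst (-1) \* ((fun x => (f x)^-1) \* (fun x => (f x)^-1) \* 'D_v f))).
  move=> x Ux; rewrite deriveV /GRing.scale /=; last 2 first.
  - exact: f0.
  - exact/diff_derivable/df.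
  by rewrite expr2 invfM mulN1r mulNr.
apply: (ndiffM oU); first exact: ndiff_cst.
by apply: (ndiffM oU); [apply: (ndiffM oU)|exact: Df].
Qed.

(** * Smooth functions on a manifold *)

Section SmoothClosure.
Context {R : realType} {M : manifold R}.
Variable A : set M.
Hypothesis oA : open A.

Lemma msmooth_flat n (f : M -> R) : msmooth A f -> msmooth A (flat n \o f).
Proof.
move=> sf c ac k; apply: (ndiff_flat (f := f \o cinv c)) (sf c ac k).
exact: open_cimage.
Qed.

Lemma msmooth_inv (f : M -> R) : (forall x, A x -> f x != 0) ->
  msmooth A f -> msmooth A (fun x => (f x)^-1).
Proof.
move=> f0 sf c ac k; apply: (ndiff_inv (f := f \o cinv c)) (sf c ac k).
  exact: open_cimage.
by move=> _ [x [Ax cx] <-] /=; rewrite cmapK// f0.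
Qed.

Lemma msmooth_cmap c : @atlas R M c -> msmooth (cdom c) (cmap c).
Proof.
move=> ac d ad k; rewrite setIC; exact: atlas_compat.
Qed.

Lemma msmooth_bigsum (I : Type) (r : seq I) (P : pred I) (f : I -> M -> R) :
  (forall i, msmooth A (f i)) ->
  msmooth A (fun x => \sum_(i <- r | P i) f i x).
Proof.
move=> sf; elim: r => [|i r IH].
  by apply: (msmooth_eq (f := cst 0)) => // [x _|]; rewrite ?big_nil//; exact: msmooth_cst.
apply: (msmooth_eq (f := fun x => (if P i then f i x else 0) +
    \sum_(j <- r | P j) f j x)) => //.
  by move=> x _; rewrite big_cons; case: ifP => // _; rewrite add0r.
apply: msmoothD => //; case: (P i) => //; exact: msmooth_cst.
Qed.

Lemma msmooth_bigprod (I : Type) (r : seq I) (P : pred I) (f : I -> M -> R) :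
  (forall i, msmooth A (f i)) ->
  msmooth A (fun x => \prod_(i <- r | P i) f i x).
Proof.
move=> sf; elim: r => [|i r IH].
  by apply: (msmooth_eq (f := cst (1 : R))) => // [x _|]; rewrite ?big_nil//; exact: msmooth_cst.
apply: (msmooth_eq (f := fun x => (if P i then f i x else 1) *
    \prod_(j <- r | P j) f j x)) => //.
  by move=> x _; rewrite big_cons; case: ifP => // _; rewrite mul1r.
apply: msmoothM => //; case: (P i) => //; exact: msmooth_cst.
Qed.

Lemma msmooth_det n (F : M -> 'M[R]_n) : msmooth A F ->
  msmooth A (fun x => \det (F x)).
Proof.
move=> /(msmooth_mxP _ oA) sF; apply: msmooth_bigsum => s.
apply: (msmoothM oA (f := cst _)); first exact: msmooth_cst.
exact: msmooth_bigprod.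
Qed.

(** Cramer's rule: the entries of the inverse are polynomials in the entries,
    divided by the determinant. *)
Lemma msmooth_invmx n (F : M -> 'M[R]_n) : (forall x, A x -> F x \in unitmx) ->
  msmooth A F -> msmooth A (fun x => invmx (F x)).
Proof.
move=> uF sF.
apply: (msmooth_eq (f := fun x => (\det (F x))^-1 *: \adj (F x))) => //.
  by move=> x /uF uFx; rewrite /invmx uFx.
apply: msmooth_scalemx => //.
  by apply: msmooth_inv => [x /uF|]; [rewrite unitmxE unitfE|exact: msmooth_det].
apply/(msmooth_mxP _ oA) => i j.
apply: (msmooth_eq (f := fun x => cofactor (F x) j i)) => //.
  by move=> x _; rewrite mxE.
apply: (msmoothM oA (f := cst _)); first exact: msmooth_cst.
apply: msmooth_det; apply/(msmooth_mxP _ oA) => k l.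
apply: (msmooth_eq (f := fun x => F x (lift j k) (lift i l))) => //.
  by move=> x _; rewrite !mxE.
exact: (msmooth_mxP _ oA).1.
Qed.

End SmoothClosure.

(** * Bump functions *)

Section Bump.
Context {R : realType} {M : manifold R}.

(** The parts of A inside U and outside K form an open cover of A, and f vanishes
    on the second one. *)
Lemma msmooth_extend0 (A U K : set M) (W : normedModType R) (f : M -> W) :
  open A -> open U -> closed K -> K `<=` U -> (forall x, ~ K x -> f x = 0) ->
  msmooth (A `&` U) f -> msmooth A f.
Proof.
move=> oA oU cK KU f0 sf; apply: msmooth_local => x Ax.
have [Ux|nUx] := pselect (U x).
  by exists (A `&` U); split=> //; exact: openI.
have oK : open (~` K) by rewrite openC.
exists (~` K); split=> //; first by move=> /KU.
apply: (msmooth_eq (f := cst 0)) => //; last exact: msmooth_cst.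
by move=> y nKy; rewrite f0.
Qed.

Lemma open_nonzero (chi : smooth_fun M) : open [set x | chi x != 0].
Proof.
rewrite openE => x /= chix; have ac : atlas (chart_at x) by exact: atlas_chart_at.
have cx := cdom_chart_at x; have oc := open_cdom ac.
have [_ _ _ cmapc _] := atlas_chart ac.
have dchi : differentiable (chi \o cinv (chart_at x)) (cmap (chart_at x) x).
  by have [+ _] := sfun_smooth chi ac 1; apply; exists x.
have nz : \forall y \near cmap (chart_at x) x, (chi \o cinv (chart_at x)) y != 0.
  by apply: cvgr_neq0 (differentiable_continuous dchi) _; rewrite /= cmapK.
have := cmapc _ cx _ nz; apply: filterS2 (open_nbhs_nbhs (conj oc cx)) => y cy.
by rewrite /= cmapK.
Qed.

Lemma compact_closed_ball n (q : 'rV[R]_n) r : 0 < r -> compact (closed_ball q r).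
Proof.
move=> r0; apply: bounded_closed_compact; last exact: closed_ball_closed.
exists (`|q| + r); split; first by rewrite num_real.
move=> b lb y; rewrite closed_ballE// /closed_ball_ /= => qy.
apply: le_trans (ltW lb).
rewrite -[y](subrK q) (le_trans (ler_normD _ _))// addrC lerD2l.
by rewrite distrC.
Qed.

(** In the preferred chart c at p, chi is flat 0 of r^2 - |c x - c p|^2, and K
    is the preimage of a closed ball. K is closed in the chart domain for free;
    it is closed in M because it is compact and M is Hausdorff, and this is
    what makes the extension of chi by zero smooth. *)
Lemma bump_function (U : set M) p : open U -> U p ->
  exists (chi : smooth_fun M) (K : set M),
    [/\ closed K, K `<=` U, forall x, ~ K x -> chi x = 0 & chi p != 0].
Proof.
move=> oU Up; set c := chart_at p.
have ac : atlas c by exact: atlas_chart_at.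
have cp : cdom c p by exact: cdom_chart_at.
have oc := open_cdom ac.
have [_ _ _ _ cinvc] := atlas_chart ac.
pose q := cmap c p.
have : nbhs q (cmap c @` (U `&` cdom c)).
  by apply: open_nbhs_nbhs; split; [exact: open_cimage|exists p].
move=> /nbhs_closedballP[r rU].
have r0 : 0 < r%:num by exact: gt0.
pose K := cinv c @` closed_ball q r%:num.
have KU : K `<=` U `&` cdom c.
  by move=> _ [y /rU[x [Ux cx] <-] <-]; rewrite cmapK.
have cK : closed K.
  apply: compact_closed; first exact: manifold_hausdorff.
  apply: continuous_compact; last exact: compact_closed_ball.
  apply: continuous_in_subspaceT => y; rewrite inE => /rU[x [_ cx] <-].
  by apply: cinvc; exists x.
(* The Euclidean distance is used since the norm of 'rV[R]_n, a maximum, is not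
   smooth; the Euclidean ball lies inside the ball of that norm. *)
pose dist2 x := \sum_(i < mdim M) (cmap c x 0 i - q 0 i) ^+ 2.
pose chi x := if `[< cdom c x >] then flat 0 (r%:num ^+ 2 - dist2 x) else 0.
have chi0 x : ~ K x -> chi x = 0.
  rewrite /chi; case: asboolP => // cx nKx; rewrite /flat ifN//.
  apply/negP; rewrite subr_gt0 => d2; apply: nKx.
  exists (cmap c x); last exact: cmapK.
  apply: subset_closed_ball; split=> // i j; rewrite [i]ord1.
  rewrite -ball_normE /ball_ /= -(ltr_pXn2r (n := 2))// ?nnegrE//.
  rewrite real_normK ?num_real// -sqrrN opprB; apply: le_lt_trans d2.
  by rewrite /dist2 (bigD1 j)//= lerDl sumr_ge0// => k _; rewrite sqr_ge0.
have schi : msmooth setT chi.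
  apply: (msmooth_extend0 (U := cdom c) (K := K)) => //.
  - exact: openT.
  - by move=> x /KU[].
  rewrite setTI.
  apply: (msmooth_eq (f := flat 0 \o (fun x => r%:num ^+ 2 + (-1) * dist2 x))) => //.
    by move=> x cx; rewrite /chi asboolT//= mulN1r.
  apply: msmooth_flat => //; apply: (msmoothD oc (f := cst _)).
    exact: msmooth_cst.
  apply: (msmoothM oc (f := cst _)); first exact: msmooth_cst.
  apply: msmooth_bigsum => // i.
  have si : msmooth (cdom c) (fun x => cmap c x 0 i - q 0 i).
    apply: (msmoothD oc (g := cst _)); last exact: msmooth_cst.
    by apply: (msmooth_mxP _ oc).1; exact: msmooth_cmap.
  exact: (msmoothM oc si si).
exists (SmoothFun schi), K; split=> //=; first by move=> x /KU[].
rewrite /chi asboolT// /dist2 big1; last by move=> i _; rewrite subrr expr0n.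
by rewrite subr0 /flat exprn_gt0.
Qed.

End Bump.

(** * Global sections from local frames *)

Section Frames.
Context {R : realType} {M : manifold R} {E : vbundle M}.
Implicit Types (t : local_triv E (rank E)) (p x : M).

(** The inverse of the trivialization t on the fibre at x, meaningful only for
    x in the domain of t. *)
Definition triv_inv t x (c : 'rV[R]_(rank E)) : E x :=
  xget 0 [set v : E x | tmap t x v = c].

Lemma triv_invK t x c : trivs t -> tdom t x -> tmap t x (triv_inv t x c) = c.
Proof.
move=> tt tx; have [g _ gK] := triv_bij tt tx.
by apply: (xgetPex 0 (P := [set v : E x | tmap t x v = c])); exists (g c); exact: gK.
Qed.

Lemma triv_inj t x : trivs t -> tdom t x -> injective (tmap t x).
Proof. by move=> tt tx; have /bij_inj := triv_bij tt tx. Qed.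

Lemma triv_scale t x (a : R) (v : E x) : trivs t -> tdom t x ->
  tmap t x (a *: v) = a *: tmap t x v.
Proof. by move=> tt tx; have L := triv_linear tt tx; rewrite (scalable_linear L). Qed.

Lemma triv_add t x (u v : E x) : trivs t -> tdom t x ->
  tmap t x (u + v) = tmap t x u + tmap t x v.
Proof. by move=> tt tx; have := triv_linear tt tx 1 u v; rewrite !scale1r. Qed.

Lemma triv0 t x : trivs t -> tdom t x -> tmap t x 0 = 0.
Proof. by move=> tt tx; rewrite -(scale0r 0) triv_scale// scale0r. Qed.

Lemma triv_sum t x (I : Type) (r : seq I) (f : I -> E x) : trivs t -> tdom t x ->
  tmap t x (\sum_(i <- r) f i) = \sum_(i <- r) tmap t x (f i).
Proof.
move=> tt tx; elim: r => [|i r IH]; first by rewrite !big_nil triv0.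
by rewrite !big_cons triv_add// IH.
Qed.

Lemma section_sumE (I : Type) (r : seq I) (s : I -> sections E) x :
  (\sum_(i <- r) s i) x = \sum_(i <- r) s i x.
Proof.
by elim: r => [|i r IH]; rewrite ?big_nil// !big_cons -IH.
Qed.

(** A section known only over the domain of t becomes global once it is
    multiplied by a function supported in that domain. *)
Lemma cutoff_section t (chi : smooth_fun M) (K : set M) (a : M -> 'rV[R]_(rank E)) :
  trivs t -> closed K -> K `<=` tdom t -> (forall x, ~ K x -> chi x = 0) ->
  msmooth (tdom t) a ->
  exists s : sections E, forall x, tdom t x -> tmap t x (s x) = chi x *: a x.
Proof.
move=> tt cK Kt chi0 sa; have ot := triv_open tt.
pose s x : E x := chi x *: triv_inv t x (a x).
have ss t' : trivs t' -> msmooth (tdom t') (fun x => tmap t' x (s x)).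
  move=> tt'; have ot' := triv_open tt'; have oI := openI ot ot'.
  apply: (msmooth_eq (f := fun x => chi x *: tmap t' x (triv_inv t x (a x)))) => //.
    by move=> x t'x; rewrite triv_scale.
  apply: (msmooth_extend0 (U := tdom t) (K := K)) => //.
    by move=> x /chi0 ->; rewrite scale0r.
  rewrite setIC; have [A sA tA] := triv_trans tt tt'.
  apply: (msmooth_eq (f := fun x => chi x *: (a x *m A x))) => //.
    by move=> x [tx t'x]; rewrite tA// triv_invK.
  apply: msmooth_scalemx => //; first exact: msmooth_sub (sfun_smooth chi).
  apply: msmooth_mulmx => //.
  by apply: msmooth_sub sa => x [].
exists (SmoothSection ss) => x tx /=.
by rewrite triv_scale// triv_invK.
Qed.

Lemma section_through p (v : E p) : exists s : sections E, s p = v.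
Proof.
have [t tt tp] := triv_cover E p.
have [chi [K [cK Kt chi0 chip]]] := bump_function (triv_open tt) tp.
have sa : msmooth (tdom t) (cst ((chi p)^-1 *: tmap t p v)).
  by apply: msmooth_cst; exact: triv_open.
have [s sE] := cutoff_section tt cK Kt chi0 sa.
by exists s; apply: (triv_inj tt tp); rewrite sE// scalerA divff// scale1r.
Qed.

(** The sections s i are chi times the frame of t, and the functions a i are chi
    times the coordinates of e in that frame. Both are global, at the price of
    the factor chi twice: this is how an operator defined on global sections
    only can be computed in a frame. *)
Lemma cutoff_frame p : exists t (chi : smooth_fun M) (s : 'I_(rank E) -> sections E),
  [/\ trivs t, chi p != 0, forall x, chi x != 0 -> tdom t x &
    forall e : sections E, exists a : 'I_(rank E) -> smooth_fun M,
      section_mul chi (section_mul chi e) = \sum_i section_mul (a i) (s i) /\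
      forall x i, chi x != 0 -> a i x = chi x * tmap t x (e x) 0 i].
Proof.
have [t tt tp] := triv_cover E p; have ot := triv_open tt.
have [chi [K [cK Kt chi0 chip]]] := bump_function ot tp.
have chit x : chi x != 0 -> tdom t x.
  by move=> chix; apply: Kt; apply: contrapT => /chi0 c0; rewrite c0 eqxx in chix.
have /choice[s sE] i : exists s : sections E,
    forall x, tdom t x -> tmap t x (s x) = chi x *: 'e_i.
  by apply: (cutoff_section tt cK Kt chi0 (a := cst _)); exact: msmooth_cst.
exists t, chi, s; split=> // e.
have sa i : msmooth setT (fun x => chi x * tmap t x (e x) 0 i).
  apply: (msmooth_extend0 (U := tdom t) (K := K)) => //.
  - exact: openT.
  - by move=> x /chi0 ->; rewrite mul0r.
  rewrite setTI; apply: msmoothM => //; first exact: msmooth_sub (sfun_smooth chi).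
  by apply: (msmooth_mxP _ ot).1; exact: sec_smooth.
exists (fun i => SmoothFun (sa i)); split=> //.
apply: sections_eq => x; rewrite section_sumE /=.
have [tx|ntx] := pselect (tdom t x); last first.
  have -> : chi x = 0 by apply: chi0 => /Kt.
  by rewrite scale0r big1// => i _; rewrite mul0r scale0r.
apply: (triv_inj tt tx); rewrite triv_sum// !triv_scale//.
rewrite {1}(row_sum_delta (tmap t x (e x))) 2!scaler_sumr; apply: eq_bigr => i _.
by rewrite triv_scale// sE// !scalerA [chi x * _ * chi x]mulrAC.
Qed.

End Frames.

(** * Representation of functionals by a nondegenerate form *)

Section Riesz.
Context {R : realType} {M : manifold R} {E : vbundle M}.
Variable w : bilinear_form E.
Hypothesis nd : nondegenerate_form w.

Lemma bilinear_form0l x (v : E x) : w x 0 v = 0.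
Proof. by have /= := form_linearl w v (-1) 0 0; rewrite scaler0 addr0 mulN1r addNr. Qed.

Lemma bilinear_formBl x (u u' v : E x) : w x (u - u') v = w x u v - w x u' v.
Proof.
have /= wl := form_linearl w v (-1) u' u.
by rewrite addrC -scaleN1r wl mulN1r addrC.
Qed.

(** A section is determined by its pairings with all global sections, since
    these reach every vector of every fibre. All the identities between sections
    below are proved by testing against an arbitrary section. *)
Lemma form_eval_inj (s s' : sections E) :
  (forall e, form_eval w s e = form_eval w s' e) -> s = s'.
Proof.
move=> H; apply: sections_eq => x; apply/eqP; rewrite -subr_eq0; apply/eqP.
apply: nd => v; have [e <-] := section_through v.
rewrite bilinear_formBl; apply/eqP; rewrite subr_eq0; apply/eqP.
exact: (congr1 (fun f : smooth_fun M => f x) (H e)).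
Qed.

(** A row vector killed by the Gram matrix gives a vector of the fibre that is
    orthogonal to the whole fibre. *)
Lemma gram_unit t (G : M -> 'M[R]_(rank E)) x : trivs t -> tdom t x ->
  (forall u v : E x, w x u v = (tmap t x u *m G x *m (tmap t x v)^T) 0 0) ->
  G x \in unitmx.
Proof.
move=> tt tx wG; rewrite -row_free_unit; apply: inj_row_free => c cG.
have : triv_inv t x c = 0.
  by apply: nd => v; rewrite wG triv_invK// cG mul0mx mxE.
by move=> /(congr1 (tmap t x)); rewrite triv_invK// triv0.
Qed.

(** A C^oo(M)-linear functional on sections is local: where chi is nonzero,
    applying it to chi^2 e = sum_i a_i s_i gives it as a smooth row vector b in
    the coordinates of e. The representing section has coordinates b G^-1, with
    G the Gram matrix; by nondegeneracy it is unique pointwise, so the local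
    representatives agree and form one smooth section. *)
Lemma riesz (phi : sections E -> smooth_fun M) :
  {morph phi : e e' / e + e'} ->
  (forall f e x, phi (section_mul f e) x = f x * phi e x) ->
  exists s, forall e, form_eval w s e = phi e.
Proof.
move=> phiD phiM.
have phi0 : phi 0 = 0 by apply: (addrI (phi 0)); rewrite -phiD !addr0.
have phi_sum (I : Type) (r : seq I) (s : I -> sections E) x :
    phi (\sum_(i <- r) s i) x = \sum_(i <- r) phi (s i) x.
  elim: r => [|i r IH]; first by rewrite !big_nil phi0.
  by rewrite !big_cons phiD -IH.
have loc p : exists (t : local_triv E (rank E)) (c : M -> 'rV[R]_(rank E)) (N : set M),
    [/\ trivs t, open N, N p & msmooth N c] /\
    forall x, N x -> tdom t x /\ forall u : E x,
      (forall e : sections E, w x u (e x) = phi e x) <-> tmap t x u = c x.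
  have [t [chi [s [tt chip chit fr]]]] := cutoff_frame (E := E) p.
  have ot := triv_open tt; have oN := open_nonzero chi.
  have [G sG wG] := form_smooth w tt.
  have uG x : chi x != 0 -> G x \in unitmx.
    by move=> /chit tx; apply: (gram_unit tt tx) => u v; exact: wG.
  pose b x := \row_i (phi (s i) x / chi x).
  have phiE e x : chi x != 0 -> phi e x = (b x *m (tmap t x (e x))^T) 0 0.
    move=> chix; have [a [ea aE]] := fr e.
    have := congr1 (fun e => phi e x) ea.
    rewrite phi_sum !phiM => H; apply: (mulfI chix); apply: (mulfI chix).
    rewrite {}H mxE !mulr_sumr; apply: eq_bigr => i _.
    by rewrite phiM aE// !mxE; field.
  exists t, (fun x => b x *m invmx (G x)), [set x | chi x != 0].
  split; first split=> //.
    have sG' : msmooth [set x | chi x != 0] G.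
      by apply: msmooth_sub sG => x /= /chit.
    apply: msmooth_mulmx => //; last by apply: msmooth_invmx.
    apply/(msmooth_mxP _ oN) => i j.
    apply: (msmooth_eq (f := fun x => phi (s j) x * (chi x)^-1)) => //.
      by move=> x _; rewrite mxE.
    apply: msmoothM => //; first exact: msmooth_sub (sfun_smooth _).
    apply: msmooth_inv => //; exact: msmooth_sub (sfun_smooth _).
  move=> x chix; have tx := chit _ chix; have uGx := uG _ chix.
  have sol (u : E x) : tmap t x u = b x *m invmx (G x) ->
      forall e : sections E, w x u (e x) = phi e x.
    by move=> uE e; rewrite wG// uE mulmxKV// phiE.
  split=> // u; split; last exact: sol.
  move=> ue; rewrite -(triv_invK (b x *m invmx (G x)) tt tx); congr tmap.
  apply/eqP; rewrite -subr_eq0; apply/eqP; apply: nd => v.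
  have [e <-] := section_through v.
  by rewrite bilinear_formBl ue sol ?subrr// triv_invK.
pose s x : E x := xget 0 [set u : E x | forall e : sections E, w x u (e x) = phi e x].
have sE x (e : sections E) : w x (s x) (e x) = phi e x.
  apply: (xgetPex 0 (P := [set u : E x | forall e : sections E, w x u (e x) = phi e x])).
  have [t [c [N [[tt oN Nx _] cE]]]] := loc x.
  have [tx uE] := cE _ Nx.
  by exists (triv_inv t x (c x)); apply/uE; exact: triv_invK.
have ss t' : trivs t' -> msmooth (tdom t') (fun x => tmap t' x (s x)).
  move=> tt'; apply: msmooth_local => p t'p.
  have [t [c [N [[tt oN Np sc] cE]]]] := loc p.
  have oA := openI oN (triv_open tt').
  exists (N `&` tdom t'); split=> //.
  have [A sA tA] := triv_trans tt tt'.
  apply: (msmooth_eq (f := fun x => c x *m A x)) => //.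
    move=> x [Nx t'x]; have [tx uE] := cE _ Nx.
    by rewrite tA//; congr mulmx; apply/esym/uE => e; exact: sE.
  apply: msmooth_mulmx => //; first by apply: msmooth_sub sc => x [].
  apply: msmooth_sub sA => x [Nx t'x]; split=> //.
  by have [] := cE _ Nx.
exists (SmoothSection ss) => e; apply: smooth_fun_eq => x; exact: sE.
Qed.

End Riesz.

(** * Derivations along the anchor *)

Section LinearFunctions.
Context {R : pzRingType} {U V : lmodType R}.
Variable f : U -> V.
Hypothesis linf : linear f.

Lemma linear_addE x y : f (x + y) = f x + f y.
Proof. by have := linf 1 x y; rewrite !scale1r. Qed.

Lemma linear_scaleE a x : f (a *: x) = a *: f x.
Proof. exact: scalable_linear. Qed.

Lemma linear_oppE x : f (- x) = - f x.
Proof. by rewrite -!scaleN1r linear_scaleE. Qed.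

End LinearFunctions.

Section Evaluation.
Context {R : realType} {M : manifold R} {E : vbundle M}.
Implicit Types (f g : smooth_fun M) (p : M) (a : R).

Lemma sfunD f g p : (f + g) p = f p + g p. Proof. by []. Qed.
Lemma sfunN f p : (- f) p = - f p. Proof. by []. Qed.
Lemma sfunZ a f p : (a *: f) p = a * f p. Proof. by []. Qed.
Lemma sfun0 p : (0 : smooth_fun M) p = 0. Proof. by []. Qed.

Fact sfun_mul_smooth f g : msmooth setT (fun x => f x * g x).
Proof. by apply: msmoothM; [exact: openT|exact: sfun_smooth..]. Qed.

Definition sfun_mul f g : smooth_fun M := SmoothFun (sfun_mul_smooth f g).

Lemma sfun_mulE f g p : sfun_mul f g p = f p * g p. Proof. by []. Qed.

Variable w : bilinear_form E.

Lemma form_eval_linearl e : linear (form_eval w ^~ e).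
Proof. by move=> a s u; apply: smooth_fun_eq => p /=; rewrite form_linearl. Qed.

Lemma form_eval_linearr e : linear (form_eval w e).
Proof. by move=> a s u; apply: smooth_fun_eq => p /=; rewrite form_linearr. Qed.

Lemma form_eval_mull f e e' :
  form_eval w (section_mul f e) e' = sfun_mul f (form_eval w e e').
Proof.
by apply: smooth_fun_eq => p /=; rewrite -[_ *: _]addr0 form_linearl bilinear_form0l addr0.
Qed.

Lemma form_eval_skew e e' : skew_form w -> form_eval w e e' = - form_eval w e' e.
Proof. by move=> sk; apply: smooth_fun_eq => p; exact: sk. Qed.

Lemma form_eval_mulr f e e' : skew_form w ->
  form_eval w e (section_mul f e') = sfun_mul f (form_eval w e e').
Proof.
move=> sk; rewrite form_eval_skew// form_eval_mull.
by apply: smooth_fun_eq => p; rewrite /= sk mulrN opprK.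
Qed.

End Evaluation.

Section Anchor.
Context {R : realType} {M : manifold R} {E : vbundle M}.
Variable rho : bundle_map E (tangent_bundle M).
Implicit Types (f g : smooth_fun M) (p : M) (a : R) (e : sections E).

Local Notation L := (anchor_derive rho).

Lemma differentiable_chart_at f p :
  differentiable (f \o cinv (chart_at p)) (cmap (chart_at p) p).
Proof.
have [+ _] := sfun_smooth f (atlas_chart_at p) 1; apply.
by exists p => //; split=> //; exact: cdom_chart_at.
Qed.

Lemma tangent_derive_linear p f :
  linear_for *%R (fun v : tangent_bundle M p => tangent_derive v f).
Proof.
move=> a u v; have d := differentiable_chart_at f p.
by rewrite /tangent_derive !deriveE// linearP.
Qed.

Lemma anchor_derive_linearl f : linear (L^~ f).
Proof.
move=> a e e'; apply: smooth_fun_eq => p /=.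
by rewrite linearP tangent_derive_linear.
Qed.

Lemma anchor_derive_mull g e f : L (section_mul g e) f = sfun_mul g (L e f).
Proof.
apply: smooth_fun_eq => p /=; rewrite linearZ.
have := tangent_derive_linear f (g p) (rho p (e p)) 0; rewrite addr0 => ->.
by have := tangent_derive_linear f (-1) (0 : tangent_bundle M p) 0;
  rewrite scaler0 addr0 mulN1r addNr => ->; rewrite addr0.
Qed.

Lemma anchor_derive_linearr e : linear (L e).
Proof.
move=> a f g; apply: smooth_fun_eq => p /=; rewrite /tangent_derive.
have df := diff_derivable (differentiable_chart_at f p).
have dg := diff_derivable (differentiable_chart_at g p).
rewrite (_ : _ \o _ = a \*: (f \o cinv (chart_at p)) + (g \o cinv (chart_at p)))//.
rewrite deriveD//; last exact: derivableZ.
by rewrite deriveZ.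
Qed.

Lemma anchor_derive_mulr e f g :
  L e (sfun_mul f g) = sfun_mul f (L e g) + sfun_mul g (L e f).
Proof.
apply: smooth_fun_eq => p /=; rewrite /tangent_derive.
have df := diff_derivable (differentiable_chart_at f p).
have dg := diff_derivable (differentiable_chart_at g p).
rewrite (_ : _ \o _ = (f \o cinv (chart_at p)) * (g \o cinv (chart_at p)))//.
by rewrite deriveM//= cmapK//; [exact: atlas_chart_at|exact: cdom_chart_at].
Qed.

End Anchor.

(** * Symplectic Lie algebroids *)

Section SymplecticAlgebroid.
Context {R : realType} {M : manifold R} {E : vbundle M}.
Variables (br : sections E -> sections E -> sections E).
Variables (rho : bundle_map E (tangent_bundle M)) (w : bilinear_form E).
Hypothesis symp : is_symplectic_lie_algebroid br rho w.
Implicit Types (x y z e : sections E) (f g : smooth_fun M) (p : M).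

Local Notation L := (anchor_derive rho).
Local Notation "''w' ( x , y )" := (form_eval w x y)
  (at level 8, format "''w' ( x ,  y )").

Let lie := symplectic_lie_algebroid symp.
Let sk := symplectic_skew symp.
Let nd := symplectic_nondegenerate symp.

Let wDl x y z : 'w(x + y, z) = 'w(x, z) + 'w(y, z).
Proof. exact: linear_addE (form_eval_linearl w z) x y. Qed.
Let wNl x z : 'w(- x, z) = - 'w(x, z).
Proof. exact: linear_oppE (form_eval_linearl w z) x. Qed.
Let wZl a x z : 'w(a *: x, z) = a *: 'w(x, z).
Proof. exact: linear_scaleE (form_eval_linearl w z) a x. Qed.
Let wDr x y z : 'w(z, x + y) = 'w(z, x) + 'w(z, y).
Proof. exact: linear_addE (form_eval_linearr w z) x y. Qed.
Let wNr x z : 'w(z, - x) = - 'w(z, x).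
Proof. exact: linear_oppE (form_eval_linearr w z) x. Qed.
Let wZr a x z : 'w(z, a *: x) = a *: 'w(z, x).
Proof. exact: linear_scaleE (form_eval_linearr w z) a x. Qed.
Let LD e f g : L e (f + g) = L e f + L e g.
Proof. exact: linear_addE (anchor_derive_linearr rho e) f g. Qed.
Let LN e f : L e (- f) = - L e f.
Proof. exact: linear_oppE (anchor_derive_linearr rho e) f. Qed.
Let LZ e a f : L e (a *: f) = a *: L e f.
Proof. exact: linear_scaleE (anchor_derive_linearr rho e) a f. Qed.
Let LDl x y f : L (x + y) f = L x f + L y f.
Proof. exact: linear_addE (anchor_derive_linearl rho f) x y. Qed.
Let LZl a x f : L (a *: x) f = a *: L x f.
Proof. exact: linear_scaleE (anchor_derive_linearl rho f) a x. Qed.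
Let brDr e x y : br e (x + y) = br e x + br e y.
Proof. exact: linear_addE (bracket_linearr lie e) x y. Qed.
Let brNr e x : br e (- x) = - br e x.
Proof. exact: linear_oppE (bracket_linearr lie e) x. Qed.
Let brDl e x y : br (x + y) e = br x e + br y e.
Proof. exact: linear_addE (bracket_linearl lie e) x y. Qed.
Let brZl e a x : br (a *: x) e = a *: br x e.
Proof. exact: linear_scaleE (bracket_linearl lie e) a x. Qed.

Lemma bracketC x y : br x y = - br y x.
Proof.
apply/eqP; rewrite -subr_eq0 opprK; apply/eqP.
have := bracket_alternating lie (x + y).
by rewrite brDr !brDl !(bracket_alternating lie) add0r addr0 addrC.
Qed.

Lemma bracket_derivation x y z : br x (br y z) = br (br x y) z + br y (br x z).
Proof.
have := bracket_jacobi lie x y z.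
rewrite (bracketC z x) (bracketC z) brNr -addrA -opprD => /eqP.
by rewrite subr_eq0 addrC => /eqP.
Qed.

(** That the anchor preserves brackets is a consequence of the other axioms:
    inserting f z in the Jacobi identity and expanding by the Leibniz rule leaves
    (L_[x,y] f - [L_x, L_y] f) z = 0 for every section z. Either some z is
    nonzero at p, or the fibre at p is trivial and the anchor vanishes there. *)
Lemma anchor_bracket x y f : L (br x y) f = L x (L y f) - L y (L x f).
Proof.
apply: smooth_fun_eq => p; apply/eqP; rewrite -subr_eq0; apply/eqP.
apply: contrapT => /eqP g0.
have fibre0 (v : E p) : v = 0.
  have [z <-] := section_through v.
  apply: nd => v'; have [u <-] := section_through v'; apply: (mulfI g0).
  have wL e g h : br e (section_mul g h) = section_mul g (br e h) + section_mul (L e g) h.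
    exact: bracket_leibniz.
  have := bracket_derivation x y (section_mul f z).
  rewrite !wL !brDr !wL.
  move=> /(congr1 (fun s => form_eval w s u)).
  rewrite !wDl !form_eval_mull.
  move=> /(congr1 (fun h : smooth_fun M => h p)).
  have := congr1 (fun s => 'w(s, u) p) (bracket_derivation x y z).
  rewrite wDl sfunD.
  rewrite !(sfunD, sfunN, sfun_mulE) => ->.
  move: ('w(br (br x y) z, u) p) ('w(br y (br x z), u) p) => c1 c2.
  move: ('w(br y z, u) p) ('w(br x z, u) p) => c3 c4.
  rewrite -[w p _ _]/('w(z, u) p); move: ('w(z, u) p) => c5.
  move: (f p) (L x f p) (L y f p) (L x (L y f) p) (L y (L x f) p).
  move: (L (br x y) f p) => b0 b1 b2 b3 b4 b5; lra.
(* The derivative of h along e at p depends on e only through e p, which is 0. *)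
have L0 e h : L e h p = 0.
  transitivity (L (0 *: e) h p); last by rewrite LZl sfunZ mul0r.
  by rewrite /= [e p]fibre0 scaler0.
by case/eqP: g0; rewrite !(sfunD, sfunN, L0) !subr0.
Qed.

Lemma gradient_exists : exists D, is_anchor_gradient rho w D.
Proof.
have /choice[D DE] f : exists s, forall e, 'w(s, e) = L e f.
  apply: (riesz nd (phi := fun e => L e f)) => [e e'|g e p].
    exact: LDl.
  by rewrite anchor_derive_mull.
by exists D.
Qed.

(** A x y represents the Lie derivative along x of the 1-form w(y, -). It is
    tensorial in z because the two derivatives of the coefficient cancel. *)
Lemma lie_derivative_exists : exists A : sections E -> sections E -> sections E,
  forall x y z, 'w(A x y, z) = L x 'w(y, z) - 'w(y, br x z).
Proof.
suff /choice[A AE] (xy : sections E * sections E) :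
    exists s, forall z, 'w(s, z) = L xy.1 'w(xy.2, z) - 'w(xy.2, br xy.1 z).
  by exists (fun x y => A (x, y)) => x y z; rewrite AE.
case: xy => x y /=.
apply: (riesz nd (phi := fun z => L x 'w(y, z) - 'w(y, br x z))) => [z z'|g z p].
  by rewrite wDr LD brDr wDr opprD addrACA.
rewrite form_eval_mulr// anchor_derive_mulr (bracket_leibniz lie) wDr !form_eval_mulr//.
rewrite !(sfunD, sfunN, sfun_mulE).
move: ('w(y, z) p) (L x 'w(y, z) p) ('w(y, br x z) p) (L x g p) (g p).
by move=> b1 b2 b3 b4 b5; ring.
Qed.

Section Product.
Variables (D : smooth_fun M -> sections E) (A : sections E -> sections E -> sections E).
Hypothesis DE : forall f e, 'w(D f, e) = L e f.
Hypothesis AE : forall x y z, 'w(A x y, z) = L x 'w(y, z) - 'w(y, br x z).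

Let wC x y : 'w(x, y) = - 'w(y, x).
Proof. exact: form_eval_skew. Qed.

Let wI x y : (forall z, 'w(x, z) = 'w(y, z)) -> x = y.
Proof. exact: form_eval_inj nd _ _. Qed.

Let DD f g : D (f + g) = D f + D g.
Proof. by apply: wI => z; rewrite wDl !DE LD. Qed.
Let DN f : D (- f) = - D f.
Proof. by apply: wI => z; rewrite wNl !DE LN. Qed.
Let DZ a f : D (a *: f) = a *: D f.
Proof. by apply: wI => z; rewrite wZl !DE LZ. Qed.
Let AD x y z : A x (y + z) = A x y + A x z.
Proof.
by apply: wI => u; rewrite wDl !AE !wDl LD opprD addrACA.
Qed.
Let AZ a x y : A x (a *: y) = a *: A x y.
Proof.
by apply: wI => u; rewrite wZl !AE !wZl LZ scalerBr.
Qed.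

Lemma symplectic_productP star : is_symplectic_product br star rho w <->
  forall x y, star x y = A x y + 2^-1 *: D 'w(x, y).
Proof.
split=> [starE x y|starE x y z].
  by apply: wI => z; rewrite starE wDl AE wZl DE addrAC.
by rewrite starE wDl AE wZl DE addrAC.
Qed.

(** L_[x,y] = [L_x, L_y] on 1-forms, from the same identity on functions and the
    Jacobi identity. *)
Lemma lie_derivative_bracket x y z : A (br x y) z = A x (A y z) - A y (A x z).
Proof.
apply: wI => u; rewrite wDl wNl !AE !(LD, LN) anchor_bracket.
rewrite (_ : br (br x y) u = br x (br y u) - br y (br x u)).
  rewrite wDr wNr.
  apply: smooth_fun_eq => p; rewrite !(sfunD, sfunN).
  move: (L x (L y 'w(z, u)) p) (L y (L x 'w(z, u)) p) => b1 b2.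
  move: (L x 'w(z, br y u) p) (L y 'w(z, br x u) p) => b3 b4.
  by move: ('w(z, br x (br y u)) p) ('w(z, br y (br x u)) p) => b5 b6; ring.
by rewrite bracket_derivation addrK.
Qed.

(** L_x commutes with the differential. *)
Lemma lie_derivative_gradient x f : A x (D f) = D (L x f).
Proof.
apply: wI => z; rewrite AE !DE anchor_bracket.
by rewrite opprB addrC subrK.
Qed.

(** This is exactly the closedness of w. *)
Lemma lie_derivative_commutator x y : A x y - A y x = br x y - D 'w(x, y).
Proof.
apply: wI => z; rewrite !wDl !wNl !AE DE.
apply: smooth_fun_eq => p.
have := congr1 (fun h : smooth_fun M => h p) (symplectic_closed symp x y z).
rewrite (wC (br x z)) (wC (br y z)) !(sfunD, sfunN) sfun0.
move: (L x 'w(y, z) p) (L y 'w(x, z) p) (L z 'w(x, y) p) => b1 b2 b3.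
by move: ('w(br x y, z) p) ('w(y, br x z) p) ('w(x, br y z) p) => b4 b5 b6; lra.
Qed.

Lemma lie_derivative_skew x y z : 'w(x, A y z) = L y 'w(x, z) + 'w(br x y, z).
Proof.
rewrite (wC x) AE (wC z x) LN (wC z) (bracketC y) wNl.
by apply: smooth_fun_eq => p; rewrite !(sfunD, sfunN) opprD !opprK.
Qed.

Variable star : sections E -> sections E -> sections E.
Hypothesis starE : forall x y, star x y = A x y + 2^-1 *: D 'w(x, y).

(** The two half gradients add up, w being skew, and compensate the gradient in
    the commutator of A. *)
Lemma star_commutator x y : star x y - star y x = br x y.
Proof.
rewrite !starE (wC y x) DN scalerN opprD opprK addrACA.
rewrite lie_derivative_commutator -scalerDl.
by rewrite (_ : 2^-1 + 2^-1 = 1 :> R) ?scale1r ?subrK//; field.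
Qed.

Lemma star_linearl e : linear (star^~ e).
Proof.
move=> a x y; rewrite !starE; apply: wI => z.
rewrite !(wDl, wZl) !AE !DE !(LDl, LZl, brDl, brZl, wDl, wZl, wDr, wZr, LD, LZ).
apply: smooth_fun_eq => p; rewrite !(sfunD, sfunN, sfunZ).
move: (L x 'w(e, z) p) (L y 'w(e, z) p) (L z 'w(x, e) p) (L z 'w(y, e) p).
by move: ('w(e, br x z) p) ('w(e, br y z) p) => b1 b2 b3 b4 b5 b6; ring.
Qed.

Lemma star_linearr e : linear (star e).
Proof.
move=> a x y; rewrite !starE AD AZ wDr wZr DD DZ !scalerDr addrACA.
by rewrite !scalerA [a * _]mulrC.
Qed.

Lemma star_anchor x y z : L x 'w(y, z) =
  'w(star x y - 2^-1 *: D 'w(x, y), z) + 'w(y, star x z - star z x).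
Proof. by rewrite starE addrK AE star_commutator subrK. Qed.

Lemma form_star x y z :
  'w(x, star y z) = L y 'w(x, z) + 'w(br x y, z) - 2^-1 *: L x 'w(y, z).
Proof. by rewrite starE wDr wZr lie_derivative_skew (wC x (D _)) DE scalerN. Qed.

(** Separates the product into the iterated Lie derivative and a gradient. *)
Lemma star_star x y z : star x (star y z) = A x (A y z) +
  D (4^-1 *: L x 'w(y, z) + 2^-1 *: (L y 'w(x, z) + 'w(br x y, z))).
Proof.
rewrite (starE x) form_star starE AD AZ lie_derivative_gradient.
rewrite -addrA -!DZ -DD; congr (_ + D _).
apply: smooth_fun_eq => p; rewrite !(sfunD, sfunN, sfunZ).
move: (L x 'w(y, z) p) (L y 'w(x, z) p) ('w(br x y, z) p) => b1 b2 b3; lra.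
Qed.

(** As star is linear, the left side is x * (y * z) - y * (x * z) - [x,y] * z.
    The iterated Lie derivatives cancel by lie_derivative_bracket, and what is
    left is the gradient of
    w([x,y], z) / 2 + (L_y w(x,z) - L_x w(y,z)) / 4, which is T / 6. *)
Lemma star_associator x y z :
  star x (star y z) - star (star x y) z - (star y (star x z) - star (star y x) z)
  = 6^-1 *: D ('w(star x y, z) + 'w(x, star y z)
    - 'w(star y x, z) - 'w(y, star x z)).
Proof.
have starB e e' : star e z - star e' z = star (e - e') z.
  have /= := star_linearl z (-1) e' e.
  by rewrite !scaleN1r [- e' + e]addrC => ->; rewrite addrC.
have -> : star x (star y z) - star (star x y) z -
    (star y (star x z) - star (star y x) z) =
    star x (star y z) - star y (star x z) - (star (star x y) z - star (star y x) z).
  by rewrite !opprD !opprK addrACA addrA.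
rewrite starB star_commutator !star_star (starE (br x y)) lie_derivative_bracket.
have cancel (P Q a b c : sections E) :
    P + a - (Q + b) - (P - Q + c) = a - b - c.
  by rewrite opprD (addrACA P) (opprD (P - Q)) (addrACA (P - Q)) subrr add0r.
rewrite {}cancel.
rewrite -!DZ -!DN -!DD; congr D.
rewrite (addrAC 'w(star x y, z)) -wNl -wDl star_commutator !form_star.
rewrite (bracketC y x) wNl.
apply: smooth_fun_eq => p; rewrite !(sfunD, sfunN, sfunZ).
move: (L x 'w(y, z) p) (L y 'w(x, z) p) ('w(br x y, z) p) => b1 b2 b3; lra.
Qed.

End Product.

End SymplecticAlgebroid.

Theorem theorem3p9 (R : realType) (M : manifold R) (E : vbundle M)
    (br : sections E -> sections E -> sections E)
    (rho : bundle_map E (tangent_bundle M)) (omega : bilinear_form E)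
    (symplectic_E : is_symplectic_lie_algebroid br rho omega) :
  (exists! star : sections E -> sections E -> sections E,
     is_symplectic_product br star rho omega) /\
  (forall star : sections E -> sections E -> sections E,
     is_symplectic_product br star rho omega ->
     is_presymplectic_algebroid star rho omega /\
     (forall e1 e2 : sections E, br e1 e2 = star e1 e2 - star e2 e1)).
Proof.
have [D DE] := gradient_exists symplectic_E.
have [A AE] := lie_derivative_exists symplectic_E.
have prodP := symplectic_productP symplectic_E DE AE.
split.
  exists (fun x y => A x y + 2^-1 *: D (form_eval omega x y)).
  split; first exact/prodP.
  by move=> star /prodP starE; apply/funext => x; apply/funext => y; rewrite starE.
move=> star /prodP starE; split; last first.
  by move=> x y; rewrite (star_commutator symplectic_E DE AE starE).
split.
- exact: symplectic_skew symplectic_E.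
- exact: symplectic_nondegenerate symplectic_E.
- exact (star_linearl symplectic_E DE AE starE).
- exact (star_linearr symplectic_E DE AE starE).
- exists D; split=> //.
    exact (star_associator symplectic_E DE AE starE).
  exact (star_anchor symplectic_E DE AE starE).
Qed.
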